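(* For every integer $n\ge 3$, $\mu_{\rm o}(L(K_n))={\rm ex}(n;K_4^-)$.
   Context: $L(K_n)$ is the line graph of the complete graph $K_n$. For a connected graph $H$ and $X\subseteq V(H)$, two vertices are $X$-visible if there is a shortest path between them whose internal vertices are not in $X$; $X$ is an outer mutual-visibility set if every two vertices of $X$ are $X$-visible and every $x\in X$, $y\in V(H)\setminus X$ are $X$-visible, and $\mu_{\rm o}(H)$ is the maximum cardinality of such a set. $K_4^-$ is $K_4$ minus one edge, and ${\rm ex}(n;H')$ is the maximum number of edges of an $n$-vertex graph not containing $H'$ as a subgraph. *)

(* Defs.v *)
From HB Require Import structures.
From mathcomp Require Import all_boot.
From mathcomp Require Import boolp.

Set Implicit Arguments.
Unset Strict Implicit.
Unset Printing Implicit Defensive.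

(* A finite simple graph on T is its set of edges, which are 2-subsets of T;
   for fixed T these graphs form a finite type. *)
Record sgraph (T : finType) := SGraph {
  edges : {set {set T}};
  edges_card2 : [forall e in edges, #|e| == 2] }.

HB.instance Definition _ (T : finType) := [isSub for @edges T].
HB.instance Definition _ (T : finType) := [Finite of sgraph T by <:].

Definition adj (T : finType) (G : sgraph T) : rel T :=
  fun x y => [set x; y] \in edges G.

Section GraphOf.
Variables (T : finType) (r : rel T).

Definition graph_of_edges : {set {set T}} :=
  [set [set p.1; p.2] | p : T * T & (p.1 != p.2) && r p.1 p.2].

Lemma graph_of_card2 : [forall e in graph_of_edges, #|e| == 2].
Proof.
by apply/forall_inP => e /imsetP[p]; rewrite inE => /andP[np _] ->; rewrite cards2 np.
Qed.

Definition graph_of : sgraph T := SGraph graph_of_card2.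

Lemma adj_graph_of (x y : T) :
  symmetric r -> adj graph_of x y = (x != y) && r x y.
Proof.
move=> rC; apply/imsetP/idP => [[[a b]] | xy]; last by exists (x, y); rewrite ?inE.
rewrite inE /= => /andP[nab rab] exy.
have cxy : x != y by move: (cards2 x y); rewrite exy cards2 nab; case: (x != y).
have: (x \in [set a; b]) && (y \in [set a; b]) by rewrite -exy !inE !eqxx orbT.
rewrite cxy !inE; case/andP => /orP[]/eqP ex /orP[]/eqP ey; subst x y => //.
- by rewrite eqxx in cxy.
- by rewrite rC.
- by rewrite eqxx in cxy.
Qed.

End GraphOf.

Definition complete_graph (n : nat) : sgraph 'I_n := graph_of (fun _ _ => true).

Definition line_graph (T : finType) (G : sgraph T) :
    sgraph {e : {set T} | e \in edges G} :=
  graph_of (fun e f => val e :&: val f != set0).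

Definition K4_minus : sgraph 'I_4 :=
  graph_of (fun x y => [set x; y] != [set inord 0; inord 1]).

Section Visibility.
Variables (T : finType) (G : sgraph T).

(* The walk of vertices x :: p, of length size p. *)
Definition is_walk (x y : T) (p : seq T) : Prop :=
  path (adj G) x p /\ last x p = y.

Definition shortest_path (x y : T) (p : seq T) : Prop :=
  is_walk x y p /\ forall q : seq T, is_walk x y q -> size p <= size q.

(* x :: p without its first and last vertices. *)
Definition internal (x : T) (p : seq T) : seq T := behead (belast x p).

Definition visible (X : {set T}) (x y : T) : Prop :=
  exists p : seq T,
    shortest_path x y p /\ forall z, z \in internal x p -> z \notin X.

Definition outer_mutual_visibility (X : {set T}) : Prop :=
  (forall x y, x \in X -> y \in X -> visible X x y) /\
  (forall x y, x \in X -> y \notin X -> visible X x y).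

Definition mu_o : nat :=
  \max_(X : {set T} | `[< outer_mutual_visibility X >]) #|X|.

End Visibility.

(* H is isomorphic to a (not necessarily induced) subgraph of G. *)
Definition contains_subgraph (U T : finType) (H : sgraph U) (G : sgraph T) : bool :=
  [exists f : {ffun U -> T},
    injectiveb f && [forall x, forall y, adj H x y ==> adj G (f x) (f y)]].

Definition ex_number (U : finType) (n : nat) (H : sgraph U) : nat :=
  \max_(G : sgraph 'I_n | ~~ contains_subgraph H G) #|edges G|.

(* Main.v *)
Require Import Defs.
From mathcomp Require Import all_boot.
From mathcomp Require Import boolp.

(** Two vertices of L(K_n) that are distinct and non-adjacent are disjoint
    edges [cd] and [ab] of K_n; they are at distance 2, and their common
    neighbours are the four edges joining [{a, b}] to [{c, d}].  So a vertex
    [cd] of X fails to see [ab] exactly when X contains [cd] and these four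
    edges, which form a K_4 minus the edge [ab].  Hence the outer
    mutual-visibility sets are the edge sets of the K_4^- -free graphs. *)

Section VisibilityAtDistanceTwo.
Variables (T : finType) (G : sgraph T).
Implicit Types (x y z : T) (X : {set T}).

Lemma visible_refl X x : visible G X x x.
Proof. by exists [::]. Qed.

Lemma walk_size_gt0 x y q : x != y -> is_walk G x y q -> 0 < size q.
Proof. by case: q => // nxy [_ /= exy]; rewrite exy eqxx in nxy. Qed.

Lemma walk_size_gt1 x y q :
  x != y -> ~~ adj G x y -> is_walk G x y q -> 1 < size q.
Proof.
case: q => [|z [|//]] nxy nadj W; first exact: walk_size_gt0 nxy W.
by case: W nadj => /=; rewrite andbT => xz <-; rewrite xz.
Qed.

Lemma visible_adj X x y : x != y -> adj G x y -> visible G X x y.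
Proof.
move=> nxy axy; exists [:: y]; split=> //; split; first by rewrite /is_walk /= axy.
by move=> q; apply: walk_size_gt0.
Qed.

Lemma visible_common_neighbour X x y z :
  x != y -> ~~ adj G x y -> adj G x z -> adj G z y -> z \notin X ->
  visible G X x y.
Proof.
move=> nxy nadj xz zy zX; exists [:: z; y]; split; last first.
  by move=> w; rewrite inE => /eqP ->.
split; first by rewrite /is_walk /= xz zy.
by move=> q; apply: walk_size_gt1.
Qed.

(** The common neighbour [w], which may lie in [X], only bounds the distance by 2. A shortest path
    then has exactly one internal vertex, and that vertex is the required [z]. *)
Lemma visible_common_neighbourP X x y w :
  x != y -> ~~ adj G x y -> adj G x w -> adj G w y -> visible G X x y ->
  exists z, [/\ adj G x z, adj G z y & z \notin X].
Proof.
move=> nxy nadj xw wy [p [[W short] pX]].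
have : size p <= 2 by apply: (short [:: w; y]); rewrite /is_walk /= xw wy.
have := walk_size_gt1 _ _ _ nxy nadj W.
case: p W pX {short} => [|z [|y' [|//]]] // [/= /and3P[xz zy' _] ey'] pX _ _.
by exists z; rewrite xz -ey' zy' pX ?inE.
Qed.

End VisibilityAtDistanceTwo.

(** A copy of K_4^- whose missing edge is [[set a; b]]; that pair may still lie in [E], since copies
    need not be induced. A bare edge set serves both [edges G] and [val @: X]. *)
Definition has_diamond {T : finType} (E : {set {set T}}) : Prop :=
  exists a b c d : T, uniq [:: a; b; c; d] /\
    [/\ [set c; d] \in E, [set c; a] \in E, [set c; b] \in E,
        [set d; a] \in E & [set d; b] \in E].

Lemma adj_K4_minus (i j : 'I_4) :
  adj K4_minus i j = (i != j) && ((1 < i) || (1 < j)).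
Proof.
rewrite adj_graph_of; last by move=> x y; rewrite setUC.
have [//|nij] := eqVneq i j; rewrite /= -[RHS]negbK; congr (~~ _).
apply/eqP/idP => [eij|].
  have : (i \in [set inord 0; inord 1 : 'I_4]) && (j \in [set inord 0; inord 1 : 'I_4]).
    by rewrite -eij !inE !eqxx orbT.
  rewrite !inE -!val_eqE /= !inordK // => /andP[].
  by do 2![case/orP=> /eqP ->].
move: nij; rewrite -val_eqE.
case: i j => [[|[|i]] Hi] [[|[|j]] Hj] //= _ _; [|rewrite setUC];
by congr [set _; _]; apply: val_inj; rewrite /= inordK.
Qed.

(** An embedding corresponds to the labelling 0, 1, 2, 3 of [a], [b], [c], [d], the non-adjacent
    pair 0, 1 going to [a], [b]. *)
Lemma contains_K4_minusP (T : finType) (G : sgraph T) :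
  contains_subgraph K4_minus G <-> has_diamond (edges G).
Proof.
split=> [/existsP[f /andP[/injectiveP injf /forallP homf]]|].
  pose v k : 'I_4 := inord k.
  have vE k : k < 4 -> v k = k :> nat by move=> ?; rewrite inordK.
  have fadj k l : k < 4 -> l < 4 -> k != l -> (1 < k) || (1 < l) ->
      [set f (v k); f (v l)] \in edges G.
    move=> k4 l4 nkl kl; move/forallP: (homf (v k)) => /(_ (v l)) /implyP; apply.
    by rewrite adj_K4_minus -val_eqE /= !vE // nkl.
  exists (f (v 0)), (f (v 1)), (f (v 2)), (f (v 3)).
  split; last by split; apply: fadj.
  by rewrite /= !inE !(inj_eq injf) -!val_eqE /= !vE.
case=> a [b [c [d [U [cd ca cb da db]]]]].
(* The default [a] is never reached, as [i < 4]. *)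
apply/existsP; exists [ffun i : 'I_4 => nth a [:: a; b; c; d] i].
apply/andP; split.
  apply/injectiveP => i j; rewrite !ffunE => /eqP.
  by rewrite nth_uniq // => /eqP /val_inj.
apply/forallP => i; apply/forallP => j; apply/implyP.
rewrite adj_K4_minus /adj !ffunE -val_eqE.
by case: i j => [[|[|[|[|i]]]] Hi] [[|[|[|[|j]]]] Hj] //= _; rewrite // setUC.
Qed.

Lemma edges_complete_graph n (e : {set 'I_n}) :
  (e \in edges (complete_graph n)) = (#|e| == 2).
Proof.
apply/imsetP/cards2P => [[[a b]]|[a [b [nab ->]]]].
  by rewrite inE andbT /= => nab ->; exists a, b.
by exists (a, b); rewrite // inE nab.
Qed.

Lemma adj_line_graph (T : finType) (G : sgraph T) e f :
  adj (line_graph G) e f = (e != f) && (val e :&: val f != set0).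
Proof. by rewrite adj_graph_of // => x y; rewrite setIC. Qed.

Lemma neq_set2 (T : finType) (a b c d : T) :
  a != c -> a != d -> [set a; b] != [set c; d].
Proof.
move=> ac ad; apply/eqP => /setP /(_ a).
by rewrite !inE eqxx (negbTE ac) (negbTE ad).
Qed.

Section LineGraphOfComplete.
Variable n : nat.
Local Notation V := {e : {set 'I_n} | e \in edges (complete_graph n)}.
Local Notation L := (line_graph (complete_graph n)).
Implicit Types (X : {set V}) (a b c d : 'I_n).

Lemma pair_edge {a b} : a != b -> [set a; b] \in edges (complete_graph n).
Proof. by move=> nab; rewrite edges_complete_graph cards2 nab. Qed.

Definition edge {a b} (nab : a != b) : V := Sub [set a; b] (pair_edge nab).

Lemma edgeP (x : V) : exists a b (nab : a != b), x = edge nab.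
Proof.
have := valP x; rewrite edges_complete_graph => /cards2P[a [b [nab ex]]].
by exists a, b, nab; apply: val_inj.
Qed.

Lemma mem_val_edge X a b (nab : a != b) :
  ([set a; b] \in val @: X) = (edge nab \in X).
Proof. exact: (mem_imset _ (edge nab) val_inj). Qed.

Lemma adj_edge a b c d (nab : a != b) (ncd : c != d) :
  adj L (edge nab) (edge ncd) =
  ([set a; b] != [set c; d]) && [|| a == c, a == d, b == c | b == d].
Proof.
rewrite adj_line_graph -val_eqE /=; congr (_ && _).
apply/set0Pn/idP => [[x]|].
  by rewrite !inE => /andP[/orP[]/eqP -> /orP[]/eqP ->]; rewrite eqxx ?orbT.
by case/or4P=> /eqP e; [exists a|exists a|exists b|exists b];
   rewrite !inE e eqxx ?orbT.
Qed.

Lemma outer_mutual_visibilityP X :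
  outer_mutual_visibility L X <-> ~ has_diamond (val @: X).
Proof.
split=> [[visI visO] [a [b [c [d [U E]]]]]|nD].
  move: U; rewrite /= !inE !negb_or !andbT.
  case/and3P=> /and3P[nab nac nad] /andP[nbc nbd] ncd.
  have [nca nda ncb ndb] : [/\ c != a, d != a, c != b & d != b].
    by rewrite ![c == _]eq_sym ![d == _]eq_sym.
  case: (E); rewrite (mem_val_edge _ _ _ ncd) => cdX _ _ _ _.
  (* The missing edge may or may not belong to [X]; the two clauses of outer mutual-visibility cover
     the two cases. *)
  have vis : visible L X (edge ncd) (edge nab).
    by have [abX|abX] := boolP (edge nab \in X); [apply: visI|apply: visO].
  have [] := visible_common_neighbourP _ _ _ _ _ (edge nca) _ _ _ _ vis.
  - by rewrite -val_eqE /= neq_set2.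
  - by rewrite adj_edge (negbTE nca) (negbTE ncb) (negbTE nda) (negbTE ndb) andbF.
  - by rewrite adj_edge eqxx /= andbT [X in X != _]setUC neq_set2 // eq_sym.
  - by rewrite adj_edge eqxx !orbT andbT neq_set2.
  move=> z []; have [u [v [nuv ->]]] := edgeP z.
  rewrite !adj_edge -(mem_val_edge X) => /andP[_ xz] /andP[_ zy] /negP; apply.
  case: E => _ ca cb da db.
  (* Since [z] meets both of two disjoint pairs, it has one endpoint in each, so it is one of the
     four joining edges, all of which lie in [X]. *)
  case/or4P: xz zy => /eqP <- /or4P[] /eqP ezy; subst;
    rewrite ?eqxx // in nca ncb nda ndb *; by rewrite // setUC.
suff vis x y : x \in X -> visible L X x y by split=> x y xX _; apply: vis.
move=> xX; have [->|nxy] := eqVneq x y; first exact: visible_refl.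
have [|nadj] := boolP (adj L x y); first exact: visible_adj.
have [c [d [ncd ex]]] := edgeP x; have [a [b [nab ey]]] := edgeP y; subst.
(* Equality of vertices is convertible to equality of the underlying pairs, so [nxy] applies and
   non-adjacency leaves disjointness. *)
move: (nadj); rewrite adj_edge -[_ != [set a; b]]/(edge ncd != edge nab).
rewrite nxy /= !negb_or => /and4P[nca ncb nda ndb].
(* A joining edge outside [X] is a common neighbour through which [x] sees [y]. If all four are in
   [X], they form a diamond with [x]. *)
have step u v (nuv : u != v) : u \in [set c; d] -> v \in [set a; b] ->
    [set u; v] \notin val @: X -> visible L X (edge ncd) (edge nab).
  rewrite !inE (mem_val_edge _ _ _ nuv) => ucd vab.
  apply: visible_common_neighbour => //; rewrite adj_edge.
    have -> /= : [set c; d] != [set u; v].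
      rewrite eq_sym [X in X != _]setUC; apply: neq_set2;
      by case/orP: vab => /eqP ->; rewrite eq_sym.
    by case/orP: ucd => /eqP ->; rewrite eqxx ?orbT.
  have -> /= : [set u; v] != [set a; b].
    by apply: neq_set2; case/orP: ucd => /eqP ->.
  by case/orP: vab => /eqP ->; rewrite eqxx ?orbT.
have [ca|] := boolP ([set c; a] \in val @: X);
  last by apply: step; rewrite // !inE eqxx ?orbT.
have [cb|] := boolP ([set c; b] \in val @: X);
  last by apply: step; rewrite // !inE eqxx ?orbT.
have [da|] := boolP ([set d; a] \in val @: X);
  last by apply: step; rewrite // !inE eqxx ?orbT.
have [db|] := boolP ([set d; b] \in val @: X);
  last by apply: step; rewrite // !inE eqxx ?orbT.
case: nD; exists a, b, c, d; split; last by rewrite (mem_val_edge _ _ _ ncd).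
rewrite /= !inE !negb_or nab ncd ![a == _]eq_sym ![b == _]eq_sym.
by rewrite nca ncb nda ndb.
Qed.

Lemma edges_card2_val X : [forall e in val @: X, #|e| == 2].
Proof.
by apply/forall_inP => e /imsetP[x _ ->]; rewrite -edges_complete_graph (valP x).
Qed.

(** Every graph on ['I_n] is a subgraph of the complete graph, so each of its edges is a vertex of
    [L]. *)
Lemma val_preimset_edges (G : sgraph 'I_n) :
  val @: [set x : V | val x \in edges G] = edges G.
Proof.
apply/setP => e; apply/imsetP/idP => [[x]|eG]; first by rewrite inE => xG ->.
have e2 : e \in edges (complete_graph n).
  by rewrite edges_complete_graph; move/forall_inP: (edges_card2 G); apply.
by exists (Sub e e2); rewrite ?inE SubK.
Qed.

End LineGraphOfComplete.

Theorem theorem3p9 (n : nat) (hn : 3 <= n) :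
  mu_o (line_graph (complete_graph n)) = ex_number n K4_minus.
Proof.
apply/eqP; rewrite eqn_leq; apply/andP; split; apply/bigmax_leqP.
  (* Read as an edge set, [X] is a K_4^- -free graph of the same size because [val] is injective. *)
  move=> X /asboolP /outer_mutual_visibilityP nD.
  rewrite -(card_imset _ val_inj).
  apply: (bigop.leq_bigmax_cond (SGraph (edges_card2_val n X))).
  by apply/negP => /contains_K4_minusP.
(* Conversely, the edges of [G], lifted to vertices of the line graph, are an outer
   mutual-visibility set. *)
move=> G nK; rewrite -val_preimset_edges card_imset; last exact: val_inj.
apply: bigop.leq_bigmax_cond; apply/asboolP/outer_mutual_visibilityP.
by rewrite val_preimset_edges => /contains_K4_minusP; apply/negP.
Qed.
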